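(* Consider the problem of maximizing $$f_{2b}(\mathbf{W},\bm{\beta})=\sum_{k=1}^{K}2\sqrt{\tilde{\alpha}_k}\,\mathrm{Re}\{\beta_k^{*}\mathbf{h}_k^H\bm{w}_k\}-\sum_{k=1}^{K}|\beta_k|^2\Big(\sum_{i=1}^{K}|\mathbf{h}_k^H\bm{w}_i|^2+\sigma_0^2\Big)$$ over $\mathbf{W}=[\bm{w}_1,\dots,\bm{w}_K]\in\mathbb{C}^{M\times K}$ and $\bm{\beta}=[\beta_1,\dots,\beta_K]^T\in\mathbb{C}^K$ subject to $\sum_{k=1}^{K}\|\bm{w}_k\|^2\le P_T$. (i) For fixed $\mathbf{W}$, the maximizer of $f_{2b}(\mathbf{W},\cdot)$ over $\bm{\beta}\in\mathbb{C}^K$ is given, for $k=1,\dots,K$, by $$\beta_k^{op}=\frac{\sqrt{\tilde{\alpha}_k}\,\mathbf{h}_k^H\bm{w}_k}{\sum_{i=1}^{K}|\mathbf{h}_k^H\bm{w}_i|^2+\sigma_0^2}.$$ (ii) With $\bm{\beta}^{op}$ so obtained held fixed, the maximizer of $f_{2b}(\cdot,\bm{\beta}^{op})$ over $\mathbf{W}$ subject to the power constraint is given, for $k=1,\dots,K$, by $$\bm{w}_k^{op}=\sqrt{\tilde{\alpha}_k}\,\beta_k^{op}\Big(\sum_{i=1}^{K}|\beta_i^{op}|^2\mathbf{h}_i\mathbf{h}_i^H+\lambda^{op}\mathbf{I}_M\Big)^{-1}\mathbf{h}_k,$$ where $\lambda^{op}$ is the dual variable of the power constraint, given by $$\lambda^{op}=\min\Big\{\lambda\ge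 0:\ \sum_{k=1}^{K}\|\bm{w}_k^{op}\|^2=P_T\Big\},$$ in which $\bm{w}_k^{op}$ is regarded as the function of $\lambda$ obtained by putting $\lambda$ in place of $\lambda^{op}$ in the preceding formula.
   Context: $M,K$ are positive integers, $P_T>0$, $\sigma_0^2>0$; $\tilde{\alpha}_k=1+\alpha_k$ with fixed $\alpha_k\ge 0$. The vectors $\mathbf{h}_k\in\mathbb{C}^{M\times 1}$ are fixed equivalent channels, $\mathbf{h}_k^H=\mathbf{h}_{r,k}^H\mathbf{\Phi}\mathbf{G}^H$, where $\mathbf{h}_{r,k}\in\mathbb{C}^{N\times 1}$, $\mathbf{G}\in\mathbb{C}^{M\times N}$, and $\mathbf{\Phi}$ is a fixed diagonal $N\times N$ matrix with unit-modulus diagonal entries. $(\cdot)^*$ is complex conjugation, $(\cdot)^H$ conjugate transpose, $\|\cdot\|$ the Euclidean norm, $\mathbf{I}_M$ the $M\times M$ identity. The set defining $\lambda^{op}$ ranges over those $\lambda\ge0$ for which the inverse exists; the formula is understood for the $\lambda^{op}$ so defined. *)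

(* Defs.v *)
From HB Require Import structures.
From mathcomp Require Import all_boot all_order all_algebra.
From mathcomp Require Import complex.
From mathcomp Require Import classical_sets reals constructive_ereal ereal.

Set Implicit Arguments.
Unset Strict Implicit.
Unset Printing Implicit Defensive.

Import Order.TTheory GRing.Theory Num.Theory.

Local Open Scope classical_set_scope.
Local Open Scope ring_scope.
Local Open Scope sesquilinear_scope.

(* Modulus as an element of R (the norm `|z| of R[i] lives in R[i]). *)
Definition cabs (R : realType) (z : R[i]) : R := ComplexField.Normc.normc z.

(* Euclidean norm; the library norm on matrices is the sup norm. *)
Definition l2norm (R : realType) (n : nat) (v : 'cV[R[i]]_n) : R :=
  Num.sqrt (\sum_(i < n) cabs (v i 0) ^+ 2).

(* All maximisers of f over D, so that argmax D f = [set x] says that x is the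
   (unique) maximiser. *)
Definition argmax (R : realType) (T : Type) (D : set T) (f : T -> R) : set T :=
  [set x | D x /\ forall y, D y -> f y <= f x].

Definition is_minimum (R : realType) (S : set R) (x : R) : Prop :=
  S x /\ lbound S x.

Section Beamforming.
Variables (R : realType) (M K : nat).
Variables (h : 'I_K -> 'cV[R[i]]_M) (alpha : 'I_K -> R) (sigma0 PT : R).

Implicit Types (W : 'M[R[i]]_(M, K)) (beta : 'cV[R[i]]_K) (lam : R).

Definition alphat (k : 'I_K) : R := 1 + alpha k.

Definition gain W (k i : 'I_K) : R[i] := ((h k)^t* *m col i W) 0 0.

Definition f2b W beta : R :=
  \sum_(k < K)
     2 * Num.sqrt (alphat k) * complex.Re ((beta k 0)^* * gain W k k)
  - \sum_(k < K)
     cabs (beta k 0) ^+ 2 * (\sum_(i < K) cabs (gain W k i) ^+ 2 + sigma0 ^+ 2).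

Definition power W : R := \sum_(k < K) l2norm (col k W) ^+ 2.

Definition feasible : set 'M[R[i]]_(M, K) := [set W | power W <= PT].

Definition beta_op W : 'cV[R[i]]_K :=
  \col_k ((Num.sqrt (alphat k))%:C%C * gain W k k
          / (\sum_(i < K) cabs (gain W k i) ^+ 2 + sigma0 ^+ 2)%:C%C).

Definition reg_gram beta lam : 'M[R[i]]_M :=
  \sum_(i < K) ((cabs (beta i 0) ^+ 2)%:C%C *: (h i *m (h i)^t*))
  + (lam%:C%C)%:M.

Definition w_op beta lam (k : 'I_K) : 'cV[R[i]]_M :=
  ((Num.sqrt (alphat k))%:C%C * beta k 0)
    *: (invmx (reg_gram beta lam) *m h k).

Definition W_op beta lam : 'M[R[i]]_(M, K) :=
  \matrix_(m, k) w_op beta lam k m 0.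

(* invmx is total (the identity map off unitmx), hence the explicit
   invertibility requirement. *)
Definition lambda_set beta : set R :=
  [set lam | [/\ 0 <= lam,
                 reg_gram beta lam \in unitmx &
                 \sum_(k < K) l2norm (w_op beta lam k) ^+ 2 = PT]].

Definition lagrangian beta W lam : R := f2b W beta + lam * (PT - power W).

Definition dual_function beta lam : \bar R :=
  ereal_sup [set (lagrangian beta W lam)%:E | W in setT].

(* Solutions of the Lagrange dual problem of maximising f2b (-, beta) under the
   power constraint: the optimal values of its dual variable. *)
Definition dual_solutions beta : set R :=
  [set lam | 0 <= lam /\
     forall mu, 0 <= mu -> (dual_function beta lam <= dual_function beta mu)%E].

End Beamforming.

(* Main.v *)
(** For fixed W the objective is a sum of strictly concave quadratics, one in
    each beta_k, and the maximiser is found by completing the square. For fixed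
    beta the quadratic part of the Lagrangian in W is minus the sum over k of
    w_k^H B w_k, with B = sum_i |beta_i|^2 h_i h_i^H + lambda I. When B is
    invertible it is positive definite, and the stationary point W_op is the
    unique maximiser of the Lagrangian. If moreover W_op uses exactly the power
    P_T, weak duality makes it the unique constrained maximiser and makes lambda
    dual optimal. Any other dual optimal mu has W_op as a maximiser of its
    Lagrangian as well, and stationarity along W_op itself reads
    (lambda - mu) P_T = 0. In particular the set defining lambda_op has at most
    one element. *)

Require Import Defs.
From mathcomp Require Import all_boot all_order all_algebra.
From mathcomp Require Import complex classical_sets reals constructive_ereal ereal.
From mathcomp Require Import ring lra.

Set Implicit Arguments.
Unset Strict Implicit.
Unset Printing Implicit Defensive.

Import Order.TTheory GRing.Theory Num.Theory.
Local Open Scope classical_set_scope.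
Local Open Scope ring_scope.
Local Open Scope sesquilinear_scope.

(** * Real parts and squared moduli of complex numbers *)

Lemma Re_conjM (R : realType) (a b : R[i]) :
  complex.Re (a^* * b)
  = complex.Re a * complex.Re b + complex.Im a * complex.Im b.
Proof. by case: a => a1 a2; case: b => b1 b2 /=; ring. Qed.

Lemma cabs_sqr (R : realType) (a : R[i]) :
  cabs a ^+ 2 = complex.Re a ^+ 2 + complex.Im a ^+ 2.
Proof. by case: a => a1 a2; rewrite /cabs /= sqr_sqrtr ?addr_ge0 ?sqr_ge0. Qed.

Lemma cabs_sqrD (R : realType) (a b : R[i]) :
  cabs (a + b) ^+ 2 = cabs a ^+ 2 + 2 * complex.Re (a^* * b) + cabs b ^+ 2.
Proof.
by rewrite !cabs_sqr Re_conjM; case: a => a1 a2; case: b => b1 b2 /=; ring.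
Qed.

Lemma cabs_sqr_eq0 (R : realType) (a : R[i]) : cabs a ^+ 2 = 0 -> a = 0.
Proof.
by move=> /eqP; rewrite sqrf_eq0 => /eqP /ComplexField.Normc.eq0_normc.
Qed.

Lemma ReD (R : realType) (a b : R[i]) :
  complex.Re (a + b) = complex.Re a + complex.Re b.
Proof. by case: a b => ? ? []. Qed.

Lemma Re_sum (R : realType) (I : Type) (r : seq I) (F : I -> R[i]) :
  complex.Re (\sum_(i <- r) F i) = \sum_(i <- r) complex.Re (F i).
Proof. by elim/big_rec2: _ => [//|i x y _ <-]; rewrite ReD. Qed.

Lemma Re_realM (R : realType) (x : R) (a : R[i]) :
  complex.Re (x%:C%C * a) = x * complex.Re a.
Proof. by case: a => a1 a2 /=; ring. Qed.

Lemma conjC_realM (R : realType) (x : R) (a : R[i]) :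
  (x%:C%C * a)^* = x%:C%C * a^*.
Proof. by rewrite rmorphM; congr (_ * _); exact: conjc_real. Qed.

(** * The real part of the Hermitian product, as a real inner product on complex columns *)

Definition rdot (R : realType) (n : nat) (u v : 'cV[R[i]]_n) : R :=
  complex.Re ((u^t* *m v) 0 0).

Lemma rdotE (R : realType) (n : nat) (u v : 'cV[R[i]]_n) :
  rdot u v = \sum_i complex.Re ((u i 0)^* * v i 0).
Proof. by rewrite /rdot mxE Re_sum; apply: eq_bigr => i _; rewrite !mxE. Qed.

Lemma rdotDl (R : realType) (n : nat) (u v w : 'cV[R[i]]_n) :
  rdot (u + v) w = rdot u w + rdot v w.
Proof.
rewrite !rdotE -big_split; apply: eq_bigr => i _.
by rewrite mxE rmorphD mulrDl ReD.
Qed.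

Lemma rdot0l (R : realType) (n : nat) (v : 'cV[R[i]]_n) : rdot 0 v = 0.
Proof. by rewrite rdotE big1 // => i _; rewrite mxE rmorph0 mul0r. Qed.

Lemma rdot_suml (R : realType) (n : nat) (I : Type) (r : seq I)
    (F : I -> 'cV[R[i]]_n) (v : 'cV[R[i]]_n) :
  rdot (\sum_(i <- r) F i) v = \sum_(i <- r) rdot (F i) v.
Proof.
elim: r => [|i r IH]; first by rewrite !big_nil rdot0l.
by rewrite !big_cons rdotDl IH.
Qed.

Lemma rdotZl (R : realType) (n : nat) (a : R[i]) (u v : 'cV[R[i]]_n) :
  rdot (a *: u) v = complex.Re (a^* * (u^t* *m v) 0 0).
Proof.
rewrite rdotE mxE mulr_sumr Re_sum; apply: eq_bigr => i _.
by rewrite !mxE rmorphM mulrA.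
Qed.

Lemma rdotZl_real (R : realType) (n : nat) (x : R) (u v : 'cV[R[i]]_n) :
  rdot (x%:C%C *: u) v = x * rdot u v.
Proof.
rewrite !rdotE mulr_sumr; apply: eq_bigr => i _.
by rewrite mxE conjC_realM -mulrA Re_realM.
Qed.

Lemma rdotZr_real (R : realType) (n : nat) (x : R) (u v : 'cV[R[i]]_n) :
  rdot u (x%:C%C *: v) = x * rdot u v.
Proof. by rewrite /rdot -scalemxAr mxE Re_realM. Qed.

Lemma l2norm_sqr (R : realType) (n : nat) (u : 'cV[R[i]]_n) :
  l2norm u ^+ 2 = \sum_i cabs (u i 0) ^+ 2.
Proof. by rewrite sqr_sqrtr // sumr_ge0 // => i _; rewrite sqr_ge0. Qed.

Lemma rdotvv (R : realType) (n : nat) (u : 'cV[R[i]]_n) :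
  rdot u u = l2norm u ^+ 2.
Proof.
rewrite l2norm_sqr rdotE; apply: eq_bigr => i _.
by rewrite Re_conjM cabs_sqr !expr2.
Qed.

Lemma l2norm_sqrD (R : realType) (n : nat) (u v : 'cV[R[i]]_n) :
  l2norm (u + v) ^+ 2 = l2norm u ^+ 2 + 2 * rdot u v + l2norm v ^+ 2.
Proof.
rewrite !l2norm_sqr rdotE mulr_sumr -!big_split.
by apply: eq_bigr => i _; rewrite mxE cabs_sqrD.
Qed.

Lemma l2norm_sqr_eq0 (R : realType) (n : nat) (u : 'cV[R[i]]_n) :
  l2norm u ^+ 2 = 0 -> u = 0.
Proof.
rewrite l2norm_sqr => /psumr_eq0P u0; apply/colP => i; rewrite mxE.
by apply/cabs_sqr_eq0/u0 => // j _; rewrite sqr_ge0.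
Qed.

(** * Quadratic expansion of the Lagrangian in [W] *)

Section Lagrangian.
Variables (R : realType) (M K : nat).
Variables (h : 'I_K -> 'cV[R[i]]_M) (alpha : 'I_K -> R) (sigma0 PT : R).

Implicit Types (W D : 'M[R[i]]_(M, K)) (beta : 'cV[R[i]]_K) (lam mu : R).

Local Notation gain := (gain h).
Local Notation reg_gram := (reg_gram h).
Local Notation lagrangian := (lagrangian h alpha sigma0 PT).
Local Notation dual_function := (dual_function h alpha sigma0 PT).
Local Notation W_op := (W_op h alpha).

Lemma gainD W D k i : gain (W + D) k i = gain W k i + gain D k i.
Proof. by rewrite /Defs.gain !linearD /= mxE. Qed.

Lemma mul_reg_gram beta lam (u : 'cV[R[i]]_M) :
  reg_gram beta lam *m u
  = \sum_k ((cabs (beta k 0) ^+ 2)%:C%C * ((h k)^t* *m u) 0 0) *: h k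
    + lam%:C%C *: u.
Proof.
rewrite mulmxDl mulmx_suml mul_scalar_mx; congr (_ + _).
apply: eq_bigr => k _; rewrite -scalemxAl -mulmxA.
(* The product of a conjugate-transposed channel with [u] is a 1 by 1 matrix, hence a scalar that
   moves in front of [h k]. *)
by rewrite {1}[(h k)^t* *m u]mx11_scalar mul_mx_scalar scalerA.
Qed.

Lemma rdot_reg_gram beta lam (u v : 'cV[R[i]]_M) :
  rdot (reg_gram beta lam *m u) v
  = \sum_k cabs (beta k 0) ^+ 2
           * complex.Re ((((h k)^t* *m u) 0 0)^* * ((h k)^t* *m v) 0 0)
    + lam * rdot u v.
Proof.
rewrite mul_reg_gram rdotDl rdot_suml rdotZl_real; congr (_ + _).
by apply: eq_bigr => k _; rewrite rdotZl conjC_realM -mulrA Re_realM.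
Qed.

Lemma quad_reg_gram beta lam (u : 'cV[R[i]]_M) :
  rdot (reg_gram beta lam *m u) u
  = \sum_k cabs (beta k 0) ^+ 2 * cabs (((h k)^t* *m u) 0 0) ^+ 2
    + lam * l2norm u ^+ 2.
Proof.
rewrite rdot_reg_gram rdotvv; congr (_ + _); apply: eq_bigr => k _.
by rewrite Re_conjM !cabs_sqr !expr2.
Qed.

Lemma quad_reg_gram_ge0 beta lam (u : 'cV[R[i]]_M) :
  0 <= lam -> 0 <= rdot (reg_gram beta lam *m u) u.
Proof.
move=> lam0; rewrite quad_reg_gram; apply: addr_ge0.
  by apply: sumr_ge0 => k _; rewrite mulr_ge0 ?sqr_ge0.
by rewrite mulr_ge0 ?sqr_ge0.
Qed.

(** The form is a sum of nonnegative terms, so all of them vanish. Each vanishing term kills the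
    matching summand of [reg_gram beta lam *m u]; that product is therefore zero, and invertibility
    gives [u = 0]. The case [lam = 0] is covered too. *)
Lemma quad_reg_gram_eq0 beta lam (u : 'cV[R[i]]_M) :
  0 <= lam -> reg_gram beta lam \in unitmx ->
  rdot (reg_gram beta lam *m u) u = 0 -> u = 0.
Proof.
move=> lam0 Bunit; rewrite quad_reg_gram => /eqP.
have term_ge0 k : true ->
    0 <= cabs (beta k 0) ^+ 2 * cabs (((h k)^t* *m u) 0 0) ^+ 2.
  by rewrite mulr_ge0 ?sqr_ge0.
have normu_ge0 : 0 <= lam * l2norm u ^+ 2 by rewrite mulr_ge0 ?sqr_ge0.
rewrite paddr_eq0 ?sumr_ge0 // => /andP[/eqP sum0 /eqP lu0].
suff Bu0 : reg_gram beta lam *m u = 0 by rewrite -[u](mulKmx Bunit) Bu0 mulmx0.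
rewrite mul_reg_gram big1 ?add0r => [|k _].
  move/eqP: lu0; rewrite mulf_eq0 => /orP[/eqP -> | /eqP /l2norm_sqr_eq0 ->].
    by rewrite scale0r.
  by rewrite scaler0.
have /eqP := psumr_eq0P term_ge0 sum0 (i := k) isT.
rewrite mulf_eq0 => /orP[/eqP -> | /eqP /cabs_sqr_eq0 ->].
  by rewrite mul0r scale0r.
by rewrite mulr0 scale0r.
Qed.

(** Exact second-order Taylor expansion at an arbitrary [W]: the left argument of the first [rdot]
    is half the gradient, and the last sum is the curvature. Invertibility is not assumed, so it
    applies to any multiplier [mu] as well. *)
Lemma lagrangianD beta lam W D :
  lagrangian beta (W + D) lam
  = lagrangian beta W lam
    + 2 * \sum_k rdot (((Num.sqrt (alphat alpha k))%:C%C * beta k 0) *: h k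
                       - reg_gram beta lam *m col k W) (col k D)
    - \sum_k rdot (reg_gram beta lam *m col k D) (col k D).
Proof.
have gradE : \sum_k rdot (((Num.sqrt (alphat alpha k))%:C%C * beta k 0) *: h k
                       - reg_gram beta lam *m col k W) (col k D)
  = \sum_k Num.sqrt (alphat alpha k) * complex.Re ((beta k 0)^* * gain D k k)
    - \sum_k cabs (beta k 0) ^+ 2
        * \sum_i complex.Re ((gain W k i)^* * gain D k i)
    - lam * \sum_k rdot (col k W) (col k D).
  (* The Gram forms have the column index outside and the index of [beta] inside; [f2b] has them the
     other way round, hence the exchange of sums. *)
  under [X in _ - X - _]eq_bigr do rewrite mulr_sumr.
  rewrite exchange_big mulr_sumr -!sumrB /=; apply: eq_bigr => k _.
  (* The minus sign becomes a scaling by the real number -1, so that [rdotZl_real] applies. *)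
  rewrite -scaleN1r -(rmorphN1 (real_complex R)) rdotDl rdotZl_real mulN1r.
  rewrite rdot_reg_gram opprD addrA; congr (_ - _ - _).
  by rewrite rdotZl conjC_realM -mulrA Re_realM.
have curvE : \sum_k rdot (reg_gram beta lam *m col k D) (col k D)
  = \sum_k cabs (beta k 0) ^+ 2 * \sum_i cabs (gain D k i) ^+ 2
    + lam * power D.
  under [X in _ = X + _]eq_bigr do rewrite mulr_sumr.
  rewrite exchange_big mulr_sumr -big_split /=; apply: eq_bigr => k _.
  by rewrite quad_reg_gram.
have powE : power (W + D)
    = power W + 2 * \sum_k rdot (col k W) (col k D) + power D.
  rewrite /power mulr_sumr -!big_split; apply: eq_bigr => k _.
  by rewrite linearD l2norm_sqrD.
have linE : \sum_k 2 * Num.sqrt (alphat alpha k)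
                   * complex.Re ((beta k 0)^* * gain (W + D) k k)
  = \sum_k 2 * Num.sqrt (alphat alpha k)
             * complex.Re ((beta k 0)^* * gain W k k)
    + 2 * \sum_k Num.sqrt (alphat alpha k)
                 * complex.Re ((beta k 0)^* * gain D k k).
  rewrite mulr_sumr -big_split; apply: eq_bigr => k _.
  by rewrite gainD mulrDr ReD /= mulrDr mulrA.
have quadE : \sum_k cabs (beta k 0) ^+ 2
                 * (\sum_i cabs (gain (W + D) k i) ^+ 2 + sigma0 ^+ 2)
  = \sum_k cabs (beta k 0) ^+ 2 * (\sum_i cabs (gain W k i) ^+ 2 + sigma0 ^+ 2)
    + 2 * (\sum_k cabs (beta k 0) ^+ 2
             * \sum_i complex.Re ((gain W k i)^* * gain D k i))
    + \sum_k cabs (beta k 0) ^+ 2 * \sum_i cabs (gain D k i) ^+ 2.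
  rewrite mulr_sumr -!big_split; apply: eq_bigr => k _ /=.
  under eq_bigr do rewrite gainD cabs_sqrD.
  by rewrite !big_split -mulr_sumr /=; ring.
rewrite gradE curvE /Defs.lagrangian /f2b linE quadE powE; ring.
Qed.

(** * The stationary point [W_op] and the constrained maximiser *)

Lemma col_W_op beta lam k : col k (W_op beta lam) = w_op h alpha beta lam k.
Proof. by apply/colP => m; rewrite !mxE. Qed.

Lemma reg_gram_w_op beta lam k : reg_gram beta lam \in unitmx ->
  reg_gram beta lam *m w_op h alpha beta lam k
  = ((Num.sqrt (alphat alpha k))%:C%C * beta k 0) *: h k.
Proof. by move=> Bunit; rewrite -scalemxAr mulKVmx. Qed.

Lemma lagrangian_W_opD beta lam D : reg_gram beta lam \in unitmx ->
  lagrangian beta (W_op beta lam + D) lam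
  = lagrangian beta (W_op beta lam) lam
    - \sum_k rdot (reg_gram beta lam *m col k D) (col k D).
Proof.
move=> Bunit; rewrite lagrangianD big1 ?mulr0 ?addr0 // => k _.
by rewrite col_W_op reg_gram_w_op // subrr rdot0l.
Qed.

Lemma lagrangian_le_W_op beta lam W :
  0 <= lam -> reg_gram beta lam \in unitmx ->
  lagrangian beta W lam <= lagrangian beta (W_op beta lam) lam.
Proof.
move=> lam0 Bunit; rewrite -[W](subrKC (W_op beta lam)) lagrangian_W_opD //.
by rewrite gerBl sumr_ge0 // => k _; exact: quad_reg_gram_ge0.
Qed.

Lemma lagrangian_max_uniq beta lam W :
  0 <= lam -> reg_gram beta lam \in unitmx ->
  lagrangian beta (W_op beta lam) lam <= lagrangian beta W lam ->
  W = W_op beta lam.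
Proof.
move=> lam0 Bunit; rewrite -[W in X in X -> _](subrKC (W_op beta lam)).
rewrite lagrangian_W_opD // lerDl oppr_ge0 => sum_le0.
set D := W - W_op beta lam in sum_le0.
have quad_ge0 k : true -> 0 <= rdot (reg_gram beta lam *m col k D) (col k D)
  by move=> _; exact: quad_reg_gram_ge0.
have /eqP/(psumr_eq0P quad_ge0) quad0 :
    \sum_k rdot (reg_gram beta lam *m col k D) (col k D) == 0.
  by rewrite eq_le sum_le0 sumr_ge0.
apply/eqP; rewrite -subr_eq0; apply/eqP/matrixP => m k.
have /colP/(_ m) := quad_reg_gram_eq0 lam0 Bunit (quad0 k isT).
by rewrite !mxE.
Qed.

Lemma power_W_op beta lam : lambda_set h alpha PT beta lam ->
  power (W_op beta lam) = PT.
Proof. by case=> _ _ <-; apply: eq_bigr => k _; rewrite col_W_op. Qed.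

Lemma lagrangian_full_power beta lam W : power W = PT ->
  lagrangian beta W lam = f2b h alpha sigma0 W beta.
Proof. by move=> pW; rewrite /Defs.lagrangian pW subrr mulr0 addr0. Qed.

Lemma argmax_W beta lam : lambda_set h alpha PT beta lam ->
  argmax (feasible PT) (fun W => f2b h alpha sigma0 W beta)
  = [set W_op beta lam].
Proof.
move=> lamS; have [lam0 Bunit _] := lamS; have pW := power_W_op lamS.
(* On the feasible set the penalty [lam * (PT - power W)] is nonnegative. *)
have weak W : feasible PT W ->
    f2b h alpha sigma0 W beta <= lagrangian beta W lam.
  by rewrite /feasible /= => fW; rewrite lerDl mulr_ge0 ?subr_ge0.
have Wfeas : feasible PT (W_op beta lam) by rewrite /feasible /= pW.
apply/seteqP; split => [W [fW maxW]|_ ->]; last first.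
  split=> // W fW; rewrite -(lagrangian_full_power beta lam pW).
  exact: le_trans (weak _ fW) (lagrangian_le_W_op _ lam0 Bunit).
(* At full power the Lagrangian of [W_op] equals its objective, which is at most that of the
   maximiser [W], hence at most the Lagrangian of [W]. *)
apply: lagrangian_max_uniq => //; rewrite lagrangian_full_power //.
exact: le_trans (maxW _ Wfeas) (weak _ fW).
Qed.

(** * The dual problem and uniqueness of its solution *)

Lemma dual_function_ge beta mu W :
  ((lagrangian beta W mu)%:E <= dual_function beta mu)%E.
Proof. by apply: ereal_sup_ubound; exists W. Qed.

Lemma dual_function_W_op beta lam : lambda_set h alpha PT beta lam ->
  dual_function beta lam = (f2b h alpha sigma0 (W_op beta lam) beta)%:E.
Proof.
move=> lamS; have [lam0 Bunit _] := lamS.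
rewrite -(lagrangian_full_power beta lam (power_W_op lamS)).
apply/le_anti/andP; split; last exact: dual_function_ge.
apply: ge_ereal_sup => _ [W _ <-].
by rewrite lee_fin; exact: lagrangian_le_W_op.
Qed.

(** Since [W_op beta lam] has full power, its Lagrangian takes the same value at every [mu]; this
    value is a lower bound for the dual function, attained at [lam]. *)
Lemma lambda_set_dual_solution beta lam : lambda_set h alpha PT beta lam ->
  dual_solutions h alpha sigma0 PT beta lam.
Proof.
move=> lamS; have [lam0 _ _] := lamS; split=> // mu _.
rewrite dual_function_W_op //.
rewrite -(lagrangian_full_power beta mu (power_W_op lamS)).
exact: dual_function_ge.
Qed.

Lemma linear_term_eq0 (a c : R) :
  0 <= c -> (forall t, 2 * t * a - t ^+ 2 * c <= 0) -> a = 0.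
Proof.
move=> c0 le0; have c1 : 0 < c + 1 by lra.
apply/eqP; rewrite -sqrf_eq0 eq_le sqr_ge0 andbT.
(* The vertex of the parabola would be [a / c]; the denominator [c + 1] avoids division by zero and
   still makes the value a positive multiple of [a ^+ 2]. *)
have := le0 (a / (c + 1)).
have -> : 2 * (a / (c + 1)) * a - (a / (c + 1)) ^+ 2 * c
          = a ^+ 2 * ((c + 2) / (c + 1) ^+ 2) by field; lra.
by rewrite pmulr_lle0 // divr_gt0 ?exprn_gt0 //; lra.
Qed.

Lemma dual_solution_uniq beta lam mu : 0 < PT ->
  lambda_set h alpha PT beta lam -> dual_solutions h alpha sigma0 PT beta mu ->
  mu = lam.
Proof.
move=> PT0 lamS [mu0 muopt]; have [lam0 Bunit _] := lamS.
have pW := power_W_op lamS.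
set W0 := W_op beta lam in pW.
(* The dual value at [mu] is at most the one at [lam], which is the Lagrangian of [W0] at [mu] by
   full power. *)
have max_mu W : lagrangian beta W mu <= lagrangian beta W0 mu.
  rewrite -lee_fin; apply: le_trans (dual_function_ge _ _ _) _.
  by rewrite lagrangian_full_power // -dual_function_W_op // muopt.
set c := \sum_k rdot (reg_gram beta mu *m col k W0) (col k W0).
have c_ge0 : 0 <= c by rewrite sumr_ge0 // => k _; exact: quad_reg_gram_ge0.
suff /eqP : (lam - mu) * PT = 0.
  by rewrite mulf_eq0 (gt_eqF PT0) orbF subr_eq0 => /eqP.
apply: (@linear_term_eq0 _ c) => // t.
(* The matrices for [lam] and [mu] differ by a multiple of the identity, so half the gradient at
   [W0] is a multiple of [W0]. *)
have gradE k : ((Num.sqrt (alphat alpha k))%:C%C * beta k 0) *: h k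
    - reg_gram beta mu *m col k W0 = (lam - mu)%:C%C *: col k W0.
  rewrite -(reg_gram_w_op _ Bunit) -col_W_op -/W0 !mul_reg_gram opprD.
  by rewrite addrACA subrr add0r -scalerBl -rmorphB.
(* Moving along [W0] itself turns the expansion into a quadratic polynomial in [t] that is never
   positive. *)
have := max_mu (W0 + t%:C%C *: W0); rewrite lagrangianD -addrA gerDl.
suff -> : \sum_k rdot (((Num.sqrt (alphat alpha k))%:C%C * beta k 0) *: h k
    - reg_gram beta mu *m col k W0) (col k (t%:C%C *: W0))
  = t * ((lam - mu) * PT).
  suff -> : \sum_k rdot (reg_gram beta mu *m col k (t%:C%C *: W0))
      (col k (t%:C%C *: W0)) = t ^+ 2 * c by rewrite mulrA.
  rewrite mulr_sumr; apply: eq_bigr => k _.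
  by rewrite linearZ -scalemxAr rdotZl_real rdotZr_real mulrA -expr2.
rewrite -pW /power !mulr_sumr; apply: eq_bigr => k _.
by rewrite gradE linearZ rdotZl_real rdotZr_real rdotvv mulrCA.
Qed.

End Lagrangian.

(** * Maximisation over [beta] for fixed [W] *)

Lemma complete_square (R : realType) (s d : R) (b g : R[i]) : 0 < d ->
  2 * s * complex.Re (b^* * g) - cabs b ^+ 2 * d
  = s ^+ 2 * cabs g ^+ 2 / d - d * cabs (b - s%:C%C * g / d%:C%C) ^+ 2.
Proof.
move=> d0; rewrite -mulrA -(fmorphV (real_complex R)) mulrC.
case: b g => b1 b2 [g1 g2]; rewrite !cabs_sqr Re_conjM /=.
by field; rewrite gt_eqF.
Qed.

(** The objective is a constant minus a weighted sum of squared distances to [bop]. The noise term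
    makes every weight [d k] positive, so a maximiser has zero loss in each coordinate. *)
Lemma argmax_beta (R : realType) (M K : nat) (h : 'I_K -> 'cV[R[i]]_M)
    (alpha : 'I_K -> R) (sigma0 : R) (W : 'M[R[i]]_(M, K)) : 0 < sigma0 ^+ 2 ->
  argmax setT (fun beta => f2b h alpha sigma0 W beta)
  = [set beta_op h alpha sigma0 W].
Proof.
move=> sigma0_gt0.
pose d k := \sum_(i < K) cabs (gain h W k i) ^+ 2 + sigma0 ^+ 2.
have d_gt0 k : 0 < d k.
  by rewrite ltr_wpDl // sumr_ge0 // => i _; rewrite sqr_ge0.
set bop := beta_op h alpha sigma0 W.
have f2bE beta : f2b h alpha sigma0 W beta
  = \sum_k Num.sqrt (alphat alpha k) ^+ 2 * cabs (gain h W k k) ^+ 2 / d k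
    - \sum_k d k * cabs (beta k 0 - bop k 0) ^+ 2.
  rewrite /f2b -!sumrB; apply: eq_bigr => k _.
  by rewrite [bop k 0]mxE -complete_square.
have loss_ge0 (beta : 'cV[R[i]]_K) k : true ->
      0 <= d k * cabs (beta k 0 - bop k 0) ^+ 2.
  by move=> _; rewrite mulr_ge0 ?sqr_ge0 ?ltW.
have f2b_bop : f2b h alpha sigma0 W bop
  = \sum_k Num.sqrt (alphat alpha k) ^+ 2 * cabs (gain h W k k) ^+ 2 / d k.
  rewrite f2bE [X in _ - X]big1 ?subr0 // => k _.
  by rewrite subrr cabs_sqr /= expr0n addr0 mulr0.
apply/seteqP; split => [beta [_ /(_ bop I)]|_ ->]; last first.
  by split=> // beta _; rewrite f2b_bop f2bE gerBl (sumr_ge0 _ (loss_ge0 beta)).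
rewrite f2b_bop f2bE lerDl oppr_ge0 => sum_le0.
have sum0 : \sum_k d k * cabs (beta k 0 - bop k 0) ^+ 2 = 0.
  by apply/le_anti/andP; split=> //; exact: sumr_ge0 (loss_ge0 beta).
apply/colP => k; apply/eqP; rewrite -subr_eq0; apply/eqP/cabs_sqr_eq0.
have /eqP := psumr_eq0P (loss_ge0 beta) sum0 (i := k) isT.
by rewrite mulf_eq0 (gt_eqF (d_gt0 k)) => /eqP.
Qed.

Theorem proposition2 (R : realType) (M N K : nat)
    (hM : (0 < M)%N) (hK : (0 < K)%N)
    (PT sigma0 : R) (hPT : 0 < PT) (hsigma0 : 0 < sigma0 ^+ 2)
    (alpha : 'I_K -> R) (halpha : forall k, 0 <= alpha k)
    (G : 'M[R[i]]_(M, N)) (hr : 'I_K -> 'cV[R[i]]_N)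
    (Phi : 'M[R[i]]_N) (hPhi_diag : is_diag_mx Phi)
    (hPhi_unit : forall n : 'I_N, cabs (Phi n n) = 1)
    (h : 'I_K -> 'cV[R[i]]_M)
    (hh : forall k, (h k)^t* = (hr k)^t* *m Phi *m G^t*) :
  forall W : 'M[R[i]]_(M, K),
    let bop := beta_op h alpha sigma0 W in
    argmax setT (fun beta => f2b h alpha sigma0 W beta) = [set bop]
    /\
    (lambda_set h alpha PT bop !=set0 ->
     exists lambda_op : R,
       [/\ is_minimum (lambda_set h alpha PT bop) lambda_op,
           dual_solutions h alpha sigma0 PT bop = [set lambda_op] &
           argmax (feasible PT) (fun W' => f2b h alpha sigma0 W' bop)
             = [set W_op h alpha bop lambda_op]]).
Proof.
move=> W bop; split; first exact: argmax_beta.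
case=> lam lamS; exists lam; split; last exact: argmax_W.
  (* Any other member of the set is dual optimal, hence equal to [lam], so the lower bound is an
     equality. *)
  split=> // mu /(lambda_set_dual_solution sigma0) mu_dual.
  by rewrite (dual_solution_uniq hPT lamS mu_dual).
apply/seteqP; split => [mu|_ ->]; last exact: lambda_set_dual_solution.
exact: dual_solution_uniq.
Qed.
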